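(* Let $\epsilon, \epsilon' > 0$ and $N \geq 1$ be real numbers. Let $\alpha$ be a real number and suppose there are integers $a$ and $q$ with $1 \leq q \leq N^{2 - \epsilon'}$, $\gcd(a,q) = 1$, and $\left|\alpha - \frac{a}{q}\right| \leq \frac{1}{q N^{2 - \epsilon'}}$. Then there exist integers $a_1, a_2, a_3$ and integers $1 \leq q_1, q_2, q_3 \leq N$ such that $$\left|\alpha - \frac{a_1}{q_1} - \frac{a_2}{q_2} - \frac{a_3}{q_3}\right| \leq \frac{C_\epsilon}{q N^{2 - \epsilon' - \epsilon}},$$ where $C_\epsilon>0$ is a constant depending only on $\epsilon$. *)

(* Defs.v *)
From Stdlib Require Export Reals ZArith.

(* Main.v *)
(** Let [K = floor N] and let [l] be about [log2 K]. Chebyshev's bound gives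
    at least [M ~ K / l] primes in [(M, K]]. For primes [y < z] among them,
    Dirichlet's theorem gives [0 < x <= M] such that [a x y z] is within [q /
    M] of a multiple [b q]. Since [x <= M < y < z], the three denominators are
    pairwise coprime, so [b / (x y z)] is a sum of three fractions with
    denominators [x], [y], [z], at distance at most [1 / (M x y z)] from [a /
    q]. This is good enough unless the distance is nonzero and [x <= X ~ M^3 /
    K^2]. For each [x], few integers [n <= K^2] put [a x n] close to, but not
    in, [q Z]; hence the products [y z], which are pairwise distinct, cannot
    all be bad for some [x <= X]. The total loss is a power of [l], which [N ^
    eps] absorbs. If [K] is at most a constant times [l], the integer part of
    [alpha] already suffices. *)

Require Import Defs.
From Stdlib Require Import Reals ZArith Lia Lra.
From mathcomp Require Import all_boot zify.

Set Implicit Arguments.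
Unset Strict Implicit.
Unset Printing Implicit Defensive.

(* [zify] rebinds the key [R] to [ring_scope]. *)
Delimit Scope R_scope with R.
Open Scope nat_scope.

(** * Chebyshev's lower bound for the number of primes *)

Lemma expn2_leq_central_bin n : 2 ^ n <= 'C(n.*2, n).
Proof.
elim: n => // n IHn; rewrite doubleS binS expnS mul2n -addnn.
apply: leq_add; apply: leq_trans IHn _; first by rewrite binS leq_addl.
by rewrite leq_bin2l.
Qed.

(** By Legendre's formula the exponent is the sum over [k] of [n.*2 %/ p ^ k - 2 * (n %/ p ^ k)].
    Each term is 0 or 1 and vanishes once [p ^ k > n.*2]. *)
Lemma pfactor_central_bin p n : prime p -> 0 < n ->
  p ^ logn p 'C(n.*2, n) <= n.*2.
Proof.
move=> p_pr n_gt0; have p_gt1 := prime_gt1 p_pr.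
have n2_gt0 : 0 < n.*2 by rewrite double_gt0.
apply: leq_trans (trunc_logP p_gt1 n2_gt0); rewrite leq_exp2l //.
set T := trunc_log p n.*2.
have le_n_2n : n <= n.*2 by rewrite -addnn leq_addr.
have bin2 : 'C(n.*2, n) * (n`! * n`!) = (n.*2)`!.
  by rewrite -(bin_fact le_n_2n) -addnn addnK.
(* Legendre's sum, padded with zero terms so that it can be compared term by term with the sum for
   the factorial of [n.*2]. *)
have logn_n : logn p n`! = \sum_(1 <= k < n.*2.+1) n %/ p ^ k.
  rewrite logn_fact // [RHS](big_cat_nat (n := n.+1)) //= [X in _ + X]big_nat.
  rewrite [X in _ + X]big1 ?addn0 // => k /andP[lt_n_k _].
  by rewrite divn_small // (leq_trans lt_n_k) // ltnW // ltn_expl.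
have: logn p (n.*2)`! <= (logn p n`!).*2 + \sum_(1 <= k < n.*2.+1) (k <= T).
  rewrite logn_fact // logn_n -[X in _ <= X + _]mul2n big_distrr -big_split /= !big_nat.
  apply: leq_sum => k _.
  case: (leqP k T) => [_|lt_T_k].
    have pk_gt0 : 0 < p ^ k by rewrite expn_gt0 ltnW.
    rewrite addn1 -ltnS ltn_divLR //; have := ltn_ceil n pk_gt0.
    by set P := p ^ k; set d := n %/ P => /=; nia.
  rewrite divn_small //.
  by apply: leq_trans (trunc_log_ltn _ p_gt1) _; rewrite leq_exp2l.
have sumT m : \sum_(1 <= k < m.+1) (k <= T) <= T.
  (* The bound [minn m T] is strong enough for induction on [m]. *)
  apply: leq_trans (_ : \sum_(1 <= k < m.+1) (k <= T) <= minn m T) _; last exact: geq_minr.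
  elim: m => [|m IHm]; first by rewrite big_geq.
  rewrite big_nat_recr //=; move: IHm; set S := bigop _ _ _; case: leqP; lia.
rewrite -bin2 !lognM ?muln_gt0 ?fact_gt0 ?bin_gt0 // => le_log.
have := sumT n.*2; lia.
Qed.

Definition primes_upto n := [seq p <- iota 0 n.+1 | prime p].

(** The central binomial coefficient is at least [2 ^ n] and is a product of prime powers, each at
    most [n.*2 <= 2 ^ l]; compare exponents of 2. *)
Lemma leq_size_primes_upto n l : n.*2 <= 2 ^ l ->
  n <= l * size (primes_upto n.*2).
Proof.
case: (posnP n) => [->//|n_gt0] le_2n_l.
have C_gt0 : 0 < 'C(n.*2, n) by rewrite bin_gt0 -addnn leq_addr.
have n2_gt0 : 0 < n.*2 by rewrite double_gt0.
rewrite -(leq_exp2l (m := 2)) // (leq_trans (expn2_leq_central_bin n)) // expnM.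
rewrite ['C(_, _)]prod_prime_decomp // prime_decompE big_map /=.
have pr_le p : p \in primes 'C(n.*2, n) -> prime p && (p <= n.*2).
  rewrite mem_primes => /and3P[p_pr _ p_dvd]; rewrite p_pr /=.
  apply: (leq_trans _ (pfactor_central_bin p_pr n_gt0)).
  have log_gt0 : 0 < logn p 'C(n.*2, n) by rewrite logn_gt0 mem_primes p_pr C_gt0.
  by rewrite -{1}(expn1 p) leq_exp2l ?prime_gt1.
apply: leq_trans (_ : (2 ^ l) ^ size (primes 'C(n.*2, n)) <= _).
  rewrite -[X in _ ^ X]sum1_size expn_sum big_seq [leqRHS]big_seq.
  apply: leq_prod => p /pr_le/andP[p_pr _]; rewrite expn1.
  exact: leq_trans (pfactor_central_bin p_pr n_gt0) le_2n_l.
rewrite leq_exp2l; last first.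
  by rewrite (leq_trans _ le_2n_l) // -addnn; lia.
apply: uniq_leq_size (primes_uniq _) _ => p /pr_le/andP[p_pr le_p].
by rewrite mem_filter p_pr mem_iota add0n ltnS.
Qed.

(** * Dirichlet's theorem and the number of near multiples *)

(** Distance from [v] to the multiples of [q] below [q / M], cleared of division. *)
Definition mod_close q M v := (v %% q * M < q) || ((q - v %% q) * M < q).

(** Dirichlet's pigeonhole: the residues of [u * 0], ..., [u * M] fall into [M] boxes of length
    [q / M], and [x] is the difference of two indices sharing a box. *)
Lemma mod_close_mul u q M : 0 < q -> 0 < M ->
  exists2 x, 0 < x <= M & mod_close q M (u * x).
Proof.
move=> q_gt0 M_gt0; pose v x := (u * x) %% q.
have ltb (x : 'I_M.+1) : v x * M %/ q < M.
  by rewrite ltn_divLR // mulnC ltn_pmul2l // ltn_pmod.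
pose box (x : 'I_M.+1) := Ordinal (ltb x).
have [x1 [x2 [lt_x eq_box]]] : exists x1 x2 : 'I_M.+1,
    x1 < x2 /\ v x1 * M %/ q = v x2 * M %/ q.
  have /injectivePn[x1 [x2 neq_x /(congr1 val)/= eq_box]] : ~~ injectiveb box.
    apply/negP => /injectiveP/leq_card; rewrite !card_ord ltnn //.
  by case: (ltngtP x1 x2) neq_x => [lt_x|lt_x|/val_inj->]; rewrite ?eqxx // => _;
     [exists x1, x2 | exists x2, x1].
exists (x2 - x1); first by rewrite subn_gt0 lt_x leq_subLR (leq_trans _ (leq_addl _ _)) // -ltnS.
have v1q : v x1 < q by rewrite ltn_pmod.
have v2q : v x2 < q by rewrite ltn_pmod.
have near : v x1 * M < v x2 * M + q /\ v x2 * M < v x1 * M + q.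
  have := (divn_eq (v x1 * M) q, divn_eq (v x2 * M) q).
  have := (ltn_pmod (v x1 * M) q_gt0, ltn_pmod (v x2 * M) q_gt0).
  rewrite eq_box; lia.
have sum_eq : u * (x2 - x1) + v x1 = v x2 %[mod q].
  by rewrite modnDmr -mulnDr subnK 1?ltnW // /v modn_mod.
rewrite /mod_close; case: (leqP (v x1) (v x2)) => [le_v|lt_v].
  have /eqP -> : (u * (x2 - x1)) %% q == v x2 - v x1.
    rewrite -(modn_small (leq_ltn_trans (leq_subr (v x1) (v x2)) v2q)).
    by rewrite -(eqn_modDr (v x1)) subnK // sum_eq.
  by apply/orP; left; rewrite mulnBl ltn_subLR ?leq_mul2r ?le_v ?orbT //; lia.
have /eqP -> : (u * (x2 - x1)) %% q == q - (v x1 - v x2).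
  have lt_q : q - (v x1 - v x2) < q by lia.
  rewrite -[X in _ == X](modn_small lt_q) -(eqn_modDr (v x1)) sum_eq.
  have -> : q - (v x1 - v x2) + v x1 = v x2 + q by lia.
  by rewrite modnDr.
apply/orP; right; rewrite subKn; last by lia.
by rewrite mulnBl; lia.
Qed.

Definition mod_near c x q M n := ~~ (q %| c * x * n) && mod_close q M (c * x * n).

(** After division by [g = gcdn x q], multiplication by [d] is invertible modulo [q'], so [n] is
    determined by [n %/ q'] and [d * n %% q']. Since exact multiples are excluded, at most
    [2 * (q' %/ M)] residues are allowed, with no extra term for the residue 0. *)
Lemma size_mod_near c x q M B : coprime c q -> 0 < q -> 0 < x -> 0 < M ->
  size (filter (mod_near c x q M) (iota 0 B.+1)) * M <= 2 * (B + q).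
Proof.
move=> co_cq q_gt0 x_gt0 M_gt0; set L := filter _ _.
set g := gcdn x q; have g_gt0 : 0 < g by rewrite gcdn_gt0 x_gt0.
have [x' def_x] : exists x', x = g * x'.
  by exists (x %/ g); rewrite mulnC divnK // dvdn_gcdl.
have [q' def_q] : exists q', q = g * q'.
  by exists (q %/ g); rewrite mulnC divnK // dvdn_gcdr.
have q'_gt0 : 0 < q' by move: q_gt0; rewrite def_q muln_gt0 => /andP[].
pose d := c * x'; have co_dq' : coprime q' d.
  rewrite coprime_sym coprimeMl; apply/andP; split.
    by apply: coprime_dvdr co_cq; rewrite def_q dvdn_mull.
  by rewrite /coprime -(eqn_pmul2l g_gt0) muln_gcdr -def_x -def_q muln1.
have cx n : c * x * n = g * (d * n) by rewrite def_x /d; lia.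
pose t := q' %/ M; have tM : t * M <= q' by rewrite leq_divM.
pose f n := (n %/ q', (d * n) %% q').
(* The second factor lists the nonzero residues within [t] of 0 modulo [q'], on both sides. *)
pose box := allpairs pair (iota 0 (B %/ q').+1) (iota 1 t ++ iota (q' - t) t).
have size_box : size box = (B %/ q').+1 * (t + t).
  by rewrite size_allpairs size_cat !size_iota.
have d_cancel n1 n2 : d * n1 == d * n2 %[mod q'] -> n1 == n2 %[mod q'].
  wlog le_n : n1 n2 / n2 <= n1.
    move=> IH; case: (leqP n2 n1) => [/IH//|/ltnW/IH{}IH].
    by rewrite eq_sym => /IH; rewrite eq_sym.
  by rewrite !eqn_mod_dvd ?leq_mul2l ?le_n ?orbT // -mulnBr Gauss_dvdr.
have f_inj : injective f.
  move=> n1 n2 [eq_div /eqP/d_cancel/eqP eq_mod].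
  by rewrite (divn_eq n1 q') (divn_eq n2 q') eq_div eq_mod.
have: size (map f L) <= size box.
  apply: uniq_leq_size => [|_ /mapP[n + ->]]; first by rewrite map_inj_uniq // filter_uniq // iota_uniq.
  rewrite mem_filter /mod_near /mod_close cx def_q -muln_modr dvdn_pmul2l //.
  rewrite -mulnBr -!(mulnA g) !ltn_pmul2l // mem_iota add0n ltnS.
  case/andP=> /andP[ndvd close] /andP[_ le_nB].
  apply/allpairsP; exists (f n); split=> //.
    by rewrite mem_iota add0n ltnS leq_div2r.
  rewrite mem_cat !mem_iota /=; move: ndvd close; rewrite /dvdn.
  have := ltn_pmod (d * n) q'_gt0; set s := _ %% _ => lt_s s_neq0 close.
  case/orP: close => lt_q; apply/orP; [left | right].
    have : s <= t by rewrite leq_divRL // ltnW.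
    lia.
  have : q' - s <= t by rewrite leq_divRL // ltnW.
  lia.
rewrite size_map size_box => le_L.
have BB : B %/ q' * q' <= B by rewrite leq_divM.
have q'q : q' <= q by rewrite def_q leq_pmull.
apply: leq_trans (_ : (B %/ q').+1 * (t + t) * M <= _); first by rewrite leq_mul2r le_L orbT.
rewrite -mulnA mulnDl; nia.
Qed.

(** * Choice of coprime denominators by counting *)

(** At most [M] primes are lost. Those that remain are coprime to every positive [x <= M]. *)
Lemma leq_card_primes_gt K M : 2 * M <= size (primes_upto K) ->
  M <= #|[set p : 'I_K.+1 | prime p & M < p]|.
Proof.
have -> : #|[set p : 'I_K.+1 | prime p & M < p]| =
    count (fun p => prime p && (M < p)) (iota 0 K.+1).
  rewrite cardsE cardE /enum_mem size_filter -enumT -val_enum_ord count_map.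
  exact: eq_count.
rewrite size_filter -[count _ _]/(count prime _) => le_2M.
have le_count (s : seq nat) : count prime s <=
    count (fun p => prime p && (M < p)) s + count (fun p => prime p && (p <= M)) s.
  by elim: s => //= p s; case: (prime p) => //=; case: leqP => /= _; lia.
have: count (fun p => prime p && (p <= M)) (iota 0 K.+1) <= size (iota 1 M).
  rewrite -size_filter; apply: uniq_leq_size; first by rewrite filter_uniq ?iota_uniq.
  move=> p; rewrite mem_filter mem_iota => /andP[/andP[/prime_gt0 p_gt0 le_pM] _].
  by rewrite mem_iota p_gt0 add1n ltnS.
have := le_count (iota 0 K.+1); rewrite size_iota; lia.
Qed.

(** A set of primes is recovered from its product as the set of its prime divisors. Hence distinct
    pairs of primes have distinct products. *)
Lemma prod_primes_inj K (A B : {set 'I_K.+1}) :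
  (forall p, p \in A -> prime p) -> (forall p, p \in B -> prime p) ->
  \prod_(p in A) (p : nat) = \prod_(p in B) (p : nat) -> A = B.
Proof.
have dvdP (C : {set 'I_K.+1}) (p : 'I_K.+1) : prime p -> (forall p, p \in C -> prime p) ->
    (p %| \prod_(r in C) (r : nat)) = (p \in C).
  move=> p_pr C_pr; rewrite Euclid_dvd_prod // big_has_cond.
  apply/idP/idP => [/hasP[r _ /andP[rC]]|pC].
    by rewrite dvdn_prime2 ?(C_pr r) // => /eqP/val_inj ->.
  by apply/hasP; exists p; rewrite /= ?mem_index_enum ?pC ?dvdnn.
move=> A_pr B_pr eq_prod; apply/setP => p.
case p_pr: (prime p); first by rewrite -!dvdP // eq_prod.
by apply/idP/idP => [/A_pr|/B_pr]; rewrite p_pr.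
Qed.

(** The pair [y], [z] is fixed first, with a product that is bad for no [x <= X]; Dirichlet's
    theorem then supplies [x]. A nonzero [d] forces [x > X], and the bounds [d * M <= 4 * K ^ 2],
    [M ^ 3 <= 40 * K ^ 2 * x] and [M ^ 2 <= y * z] multiply to the claim. *)
Lemma exists_good_denominators K M q a : 2 < M -> 0 < q -> coprime a q ->
  q <= 4 * K ^ 2 -> 2 * M <= size (primes_upto K) ->
  exists x y z, [/\ 0 < x <= K, 0 < y <= K & 0 < z <= K] /\
    [/\ coprime x y, coprime x z & coprime y z] /\
    exists b d, (a * (x * y * z) = b * q + d \/ a * (x * y * z) + d = b * q) /\
      d * M ^ 6 <= 160 * K ^ 4 * (x * y * z).
Proof.
move=> M_gt2 q_gt0 co_aq le_q le_primes.
have M_gt0 : 0 < M by apply: leq_trans M_gt2.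
set P := [set p : 'I_K.+1 | prime p & M < p].
have cardP : M <= #|P| by exact: leq_card_primes_gt.
pose T := [set A : {set 'I_K.+1} | A \subset P & #|A| == 2].
have K_gt0 : 0 < K by move: le_q; case: (K) => //; rewrite muln0 leqNgt q_gt0.
have le_MK : M < K.
  have /card_gt0P[p] : 0 < #|P| by apply: leq_trans cardP.
  rewrite inE => /andP[_ lt_Mp]; apply: leq_trans lt_Mp _.
  by rewrite -ltnS.
pose f (A : {set 'I_K.+1}) := \prod_(p in A) (p : nat).
(* Each [x] spoils at most [2 * (K ^ 2 + q) / M <= 10 * K ^ 2 / M] products, so 40 keeps the bad
   ones down to [M ^ 2 / 4], fewer than the pairs. *)
pose X := M ^ 3 %/ (40 * K ^ 2).
have XM : X * (40 * K ^ 2) <= M ^ 3 by rewrite leq_divM.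
have X_lt : M ^ 3 < X.+1 * (40 * K ^ 2) by rewrite ltn_ceil // muln_gt0 expn_gt0 K_gt0.
pose bad := [seq n | x <- iota 1 X, n <- filter (mod_near a x q M) (iota 0 (K ^ 2).+1)].
have size_bad : size bad * M <= X * (10 * K ^ 2).
  rewrite size_allpairs_dep sumnE big_map big_distrl /= big_seq.
  apply: leq_trans (_ : \sum_(x <- iota 1 X | x \in iota 1 X) 10 * K ^ 2 <= _).
    apply: leq_sum => x; rewrite mem_iota => /andP[x_gt0 _].
    apply: leq_trans (size_mod_near _ co_aq q_gt0 x_gt0 M_gt0) _; lia.
  by rewrite -big_seq big_const_seq count_predT size_iota iter_addn_0 mulnC.
have [A AT f_good] : exists2 A, A \in T & f A \notin bad.
  apply/exists_inP; apply: contraT; rewrite negb_exists_in => /forall_inP all_bad.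
  have: size (map f (enum T)) <= size bad.
    apply: uniq_leq_size.
      rewrite map_inj_in_uniq ?enum_uniq // => A B.
      rewrite !mem_enum !inE => /andP[/subsetP AP _] /andP[/subsetP BP _].
      by apply: prod_primes_inj => p; [move/AP | move/BP]; rewrite inE => /andP[].
    by move=> _ /mapP[A AT ->]; have := all_bad A; rewrite -mem_enum negbK => ->.
  rewrite size_map -cardE cards_draws => le_bad.
  have : 'C(M, 2) <= size bad by apply: leq_trans le_bad; apply: leq_bin2l.
  rewrite bin2 => le_C.
  (* The successor allows for the rounded half in [bin2]; [2 < M] still yields a contradiction. *)
  have : M * M.-1 <= (size bad).*2.+1.
    by rewrite -[M * _]odd_double_half -addn1 addnC leq_add ?leq_double // leq_b1.
  case: (M) M_gt2 M_gt0 size_bad XM => // m m_gt1 _ /= size_bad XM le_m.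
  have : size bad * m.+1 * 4 <= m.+1 ^ 3 by nia.
  rewrite !expnS expn0; nia.
move: AT; rewrite inE => /andP[/subsetP AP /cards2P[y [z [neq_yz def_A]]]].
have [yA zA] : y \in A /\ z \in A by rewrite def_A !inE !eqxx orbT.
move: (AP _ yA) (AP _ zA); rewrite !inE => /andP[y_pr lt_My] /andP[z_pr lt_Mz].
have fA : f A = y * z.
  by rewrite /f def_A big_setU1 ?big_set1 // inE.
have le_yK : y <= K by rewrite -ltnS.
have le_zK : z <= K by rewrite -ltnS.
have [x /andP[x_gt0 le_xM] close] := mod_close_mul (a * (y * z)) q_gt0 M_gt0.
have co_x (p : nat) : prime p -> M < p -> coprime x p.
  move=> p_pr lt_Mp; rewrite coprime_sym prime_coprime //.
  by apply/negP => /(dvdn_leq x_gt0); lia.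
exists x, y, z; split; first by rewrite x_gt0 !prime_gt0 ?le_yK ?le_zK //; split=> //; lia.
split; first by rewrite !co_x // prime_coprime // dvdn_prime2.
have axyz : a * (x * y * z) = a * (y * z) * x by lia.
rewrite axyz; set v := a * (y * z) * x in close *.
have [q_dvd|q_ndvd] := boolP (q %| v).
  by exists (v %/ q), 0; rewrite divnK // addn0; split=> //; left.
have lt_Xx : X < x.
  rewrite ltnNge; apply: contra f_good => le_xX; rewrite fA.
  apply/allpairsPdep; exists x, (y * z); rewrite mem_iota x_gt0 add1n ltnS.
  split=> //; rewrite mem_filter /mod_near mulnAC -/v q_ndvd close mem_iota /=.
  by rewrite add0n ltnS -mulnn leq_mul.
have bound d : d * M < q -> d * M ^ 6 <= 160 * K ^ 4 * (x * y * z).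
  move=> lt_q; have le1 : d * M <= 4 * K ^ 2 by lia.
  have le2 : M ^ 3 <= x * (40 * K ^ 2).
    by apply: leq_trans (ltnW X_lt) _; rewrite leq_mul2r lt_Xx orbT.
  have le3 : M ^ 2 <= y * z by rewrite -mulnn leq_mul // ltnW.
  have -> : d * M ^ 6 = (d * M) * M ^ 3 * M ^ 2 by rewrite !expnS expn0; lia.
  apply: leq_trans (leq_mul (leq_mul le1 le2) le3) _.
  by rewrite (_ : K ^ 4 = K ^ 2 * K ^ 2) -?expnD //; set k := K ^ 2; lia.
have v_lt := ltn_pmod v q_gt0.
case/orP: close => [/bound le_d|/bound le_d].
  by exists (v %/ q), (v %% q); split=> //; left; apply: divn_eq.
exists (v %/ q).+1, (q - v %% q); split=> //; right.
by have := divn_eq v q; lia.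
Qed.

Lemma exists_denominators K l q a : K < 2 ^ l -> 0 < l -> 18 * l <= K ->
  0 < q -> coprime a q -> q <= 4 * K ^ 2 ->
  exists x y z, [/\ 0 < x <= K, 0 < y <= K & 0 < z <= K] /\
    [/\ coprime x y, coprime x z & coprime y z] /\
    exists b d, (a * (x * y * z) = b * q + d \/ a * (x * y * z) + d = b * q) /\
      d * K ^ 2 <= 160 * (8 * l) ^ 6 * (x * y * z).
Proof.
move=> lt_K l_gt0 le_lK q_gt0 co_aq le_q.
(* The factor 6 leaves room for [2 * M] primes among the [K./2 / l] guaranteed up to [K]. As
   [18 * l <= K] gives [M >= 3], also [K < (M + 1) * 6 * l <= 8 * l * M], whence the 8 in the
   bound. *)
pose M := K %/ (6 * l).
have l6_gt0 : 0 < 6 * l by rewrite muln_gt0.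
have M_gt2 : 2 < M by rewrite leq_divRL // mulnA.
have le_M : M * (6 * l) <= K by rewrite leq_divM.
have lt_M : K < M.+1 * (6 * l) by rewrite ltn_ceil.
have le_primes : 2 * M <= size (primes_upto K).
  (* Chebyshev's bound is stated at even arguments, so [K] is rounded down. *)
  have halfK : K./2.*2 <= K by rewrite -[leqRHS]odd_double_half leq_addl.
  have sub : size (primes_upto K./2.*2) <= size (primes_upto K).
    apply: uniq_leq_size; first by rewrite filter_uniq ?iota_uniq.
    move=> p; rewrite !mem_filter !mem_iota !add0n !ltnS /= => /andP[-> /=].
    by move/leq_trans; apply.
  have le_half : K./2 <= l * size (primes_upto K).
    apply: leq_trans (leq_size_primes_upto _) (leq_mul (leqnn l) sub).
    exact: leq_trans halfK (ltnW lt_K).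
  have K_half : K <= (K./2).*2.+1.
    by rewrite -[leqLHS]odd_double_half -add1n leq_add2r leq_b1.
  rewrite leqNgt; apply/negP; set s := size _ in le_half *.
  nia.
have [x [y [z [le_K [co [b [d [def_b le_d]]]]]]]] :=
  exists_good_denominators M_gt2 q_gt0 co_aq le_q le_primes.
exists x, y, z; split=> //; split=> //; exists b, d; split=> //.
have K4_gt0 : 0 < K ^ 4 by rewrite expn_gt0; apply/orP; left; lia.
rewrite -(leq_pmul2r K4_gt0) -mulnA -expnD.
have le_K6 : K ^ (2 + 4) <= (8 * l) ^ 6 * M ^ 6.
  by rewrite -expnMn leq_exp2r //; nia.
apply: leq_trans (leq_mul (leqnn d) le_K6) _; rewrite mulnCA.
by apply: leq_trans (leq_mul (leqnn _) le_d) _; rewrite !mulnA; lia.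
Qed.

(** * From coprime denominators to sums of three fractions *)

Lemma coprime_bezoutZ (m n : nat) : 0 < m -> coprime m n ->
  exists u v : Z, (u * Z.of_nat m + v * Z.of_nat n = 1)%Z.
Proof.
move=> m_gt0 /(coprimeP n m_gt0)[[u v] /= eq1].
by exists (Z.of_nat u), (- Z.of_nat v)%Z; nia.
Qed.

Lemma coprime_of_Zgcd (m n : nat) :
  Z.gcd (Z.of_nat m) (Z.of_nat n) = 1%Z -> coprime m n.
Proof.
move=> gcd1; have /dvdnP[u def_m] := dvdn_gcdl m n.
have /dvdnP[v def_n] := dvdn_gcdr m n.
have : (Z.of_nat (gcdn m n) | 1)%Z.
  rewrite -gcd1; apply: Z.gcd_greatest; [exists (Z.of_nat u) | exists (Z.of_nat v)]; lia.
by move/Z.divide_1_r_nonneg => /(_ (Nat2Z.is_nonneg _)); rewrite /coprime; lia.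
Qed.

(** Two Bezout relations, [u x + v y = 1] and [w x y + t z = 1], give
    [b = b t v y z + b t u x z + b w x y]; divide by [x y z]. *)
Lemma three_fractions (x y z b : nat) : 0 < x -> 0 < y -> 0 < z ->
  coprime x y -> coprime x z -> coprime y z ->
  exists a1 a2 a3 : Z,
    (IZR a1 / IZR (Z.of_nat x) + IZR a2 / IZR (Z.of_nat y) + IZR a3 / IZR (Z.of_nat z)
     = IZR (Z.of_nat b) / IZR (Z.of_nat (x * y * z)))%R.
Proof.
move=> x_gt0 y_gt0 z_gt0 co_xy co_xz co_yz.
have [u [v uv]] := coprime_bezoutZ x_gt0 co_xy.
have xy_gt0 : 0 < x * y by rewrite muln_gt0 x_gt0.
have [w [t wt]] : exists w t : Z, (w * Z.of_nat (x * y) + t * Z.of_nat z = 1)%Z.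
  by apply: coprime_bezoutZ; rewrite // coprimeMl co_xz.
pose B := Z.of_nat b; exists (B * t * v)%Z, (B * t * u)%Z, (B * w)%Z.
have IZR_neq0 (n : nat) : 0 < n -> IZR (Z.of_nat n) <> 0%R.
  by move=> n_gt0; apply: IZR_neq; lia.
have [[x0 y0] z0] := (IZR_neq0 _ x_gt0, IZR_neq0 _ y_gt0, IZR_neq0 _ z_gt0).
move: uv wt; rewrite !Nat2Z.inj_mul -/B => /(congr1 IZR) uv /(congr1 IZR) wt.
move: uv wt; rewrite !plus_IZR !mult_IZR => uv wt.
set X := IZR (Z.of_nat x) in x0 uv wt *; set Y := IZR (Z.of_nat y) in y0 uv wt *.
set Z' := IZR (Z.of_nat z) in z0 wt *.
apply: (Rmult_eq_reg_r (X * Y * Z')); last first.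
  by apply: Rmult_integral_contrapositive_currified => //;
     apply: Rmult_integral_contrapositive_currified.
transitivity (IZR B * (IZR t * Z' * (IZR u * X + IZR v * Y) + IZR w * (X * Y)))%R.
  by field.
rewrite uv; transitivity (IZR B * (IZR w * (X * Y) + IZR t * Z'))%R; first by ring.
by rewrite wt; field.
Qed.

(** The residue [r] of [a] modulo [q] replaces [a], and the quotient [k] returns in the first
    numerator as [k * x]. The error is exactly [d / (x y z q)]. *)
Lemma exists_three_fractions (K l : nat) (a q : Z) :
  K < 2 ^ l -> 0 < l -> 18 * l <= K ->
  (1 <= q)%Z -> (q <= 4 * Z.of_nat K ^ 2)%Z -> Z.gcd a q = 1%Z ->
  exists a1 a2 a3 q1 q2 q3 : Z,
    ((1 <= q1 <= Z.of_nat K) /\ (1 <= q2 <= Z.of_nat K) /\ (1 <= q3 <= Z.of_nat K))%Z /\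
    (Rabs (IZR a / IZR q - IZR a1 / IZR q1 - IZR a2 / IZR q2 - IZR a3 / IZR q3)
       * (IZR q * IZR (Z.of_nat K) ^ 2) <= 160 * (8 * IZR (Z.of_nat l)) ^ 6)%R.
Proof.
move=> lt_K l_gt0 le_lK q_ge1 le_q gcd1.
have mod_lt := Z.mod_pos_bound a q ltac:(lia).
pose r := Z.to_nat (a mod q); pose m := Z.to_nat q; pose k := (a / q)%Z.
have def_q : q = Z.of_nat m by rewrite /m; lia.
have def_a : a = (k * q + Z.of_nat r)%Z.
  by rewrite /r Z2Nat.id /k; [rewrite {1}(Z.div_mod a q); lia | lia].
have m_gt0 : 0 < m by lia.
have co_rm : coprime r m.
  by apply: coprime_of_Zgcd; rewrite -def_q /r Z2Nat.id; [rewrite Z.gcd_mod; [rewrite Z.gcd_comm | lia] | lia].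
have le_m : m <= 4 * K ^ 2 by rewrite !expnS expn0; lia.
have [x [y [z [[/andP[x_gt0 x_le] /andP[y_gt0 y_le] /andP[z_gt0 z_le]]
  [[co_xy co_xz co_yz] [b [d [def_b le_d]]]]]]]] :=
  exists_denominators lt_K l_gt0 le_lK m_gt0 co_rm le_m.
have [a1 [a2 [a3 sum_a]]] := three_fractions b x_gt0 y_gt0 z_gt0 co_xy co_xz co_yz.
exists (a1 + k * Z.of_nat x)%Z, a2, a3, (Z.of_nat x), (Z.of_nat y), (Z.of_nat z).
split; first by lia.
have IZR_gt0 (n : nat) : 0 < n -> (0 < IZR (Z.of_nat n))%R.
  by move=> n_gt0; apply: IZR_lt; lia.
have xyz_gt0 : 0 < x * y * z by rewrite !muln_gt0 x_gt0 y_gt0.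
have := IZR_gt0 _ m_gt0; have := IZR_gt0 _ xyz_gt0; have := IZR_gt0 _ x_gt0.
rewrite def_a plus_IZR (plus_IZR a1) !mult_IZR def_q => x_pos p_pos m_pos.
set p := IZR (Z.of_nat (x * y * z)) in sum_a p_pos.
have -> : ((IZR k * IZR (Z.of_nat m) + IZR (Z.of_nat r)) / IZR (Z.of_nat m) -
   (IZR a1 + IZR k * IZR (Z.of_nat x)) / IZR (Z.of_nat x) - IZR a2 / IZR (Z.of_nat y) -
   IZR a3 / IZR (Z.of_nat z) = IZR (Z.of_nat r) / IZR (Z.of_nat m) - IZR (Z.of_nat b) / p)%R.
  rewrite -sum_a; field; split; [| split; [|split]]; apply: Rgt_not_eq => //; exact: IZR_gt0.
have -> : Rabs (IZR (Z.of_nat r) / IZR (Z.of_nat m) - IZR (Z.of_nat b) / p) =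
    (IZR (Z.of_nat d) / (p * IZR (Z.of_nat m)))%R.
  have -> : (IZR (Z.of_nat r) / IZR (Z.of_nat m) - IZR (Z.of_nat b) / p =
    (IZR (Z.of_nat r) * p - IZR (Z.of_nat b) * IZR (Z.of_nat m)) / (p * IZR (Z.of_nat m)))%R.
    by field; lra.
  have pm_gt0 := Rmult_lt_0_compat _ _ p_pos m_pos.
  rewrite /Rdiv Rabs_mult Rabs_inv (Rabs_pos_eq (p * _)); last lra.
  (* Both alternatives of [def_b] give the same absolute value [d]. *)
  congr (_ * _)%R; rewrite /p -!mult_IZR -minus_IZR -abs_IZR; congr IZR; lia.
have -> : (IZR (Z.of_nat d) / (p * IZR (Z.of_nat m)) * (IZR (Z.of_nat m) * IZR (Z.of_nat K) ^ 2)
  = IZR (Z.of_nat d) * IZR (Z.of_nat K) ^ 2 / p)%R by field; lra.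
apply: (Rmult_le_reg_r p) => //; rewrite /Rdiv Rmult_assoc Rinv_l ?Rmult_1_r; last lra.
have : (Z.of_nat d * Z.of_nat K ^ 2 <= 160 * (8 * Z.of_nat l) ^ 6 * Z.of_nat (x * y * z))%Z.
  by lia.
by move/IZR_le; rewrite -(mult_IZR 8) !pow_IZR -!mult_IZR.
Qed.

(** * Real parameters and the logarithmic loss *)

(** From [2 ^ t <= N] follows [t * ln 2 <= ln N], and [1 + delta * ln N <= Rpower N delta] by
    convexity of the exponential. The summand 1 in the constant pays for the successor. *)
Lemma trunc_log_le_Rpower (K : nat) (N delta : R) : 0 < K ->
  (IZR (Z.of_nat K) <= N -> 0 < delta ->
   IZR (Z.of_nat (trunc_log 2 K).+1) <= (1 + / (delta * ln 2)) * Rpower N delta)%R.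
Proof.
move=> K_gt0 le_KN delta_gt0; set t := trunc_log 2 K.
have ln2_gt0 : (0 < ln 2)%R by rewrite -ln_1; apply: ln_increasing; lra.
have pow_t : (2 ^ t <= IZR (Z.of_nat K))%R.
  rewrite (pow_IZR 2); apply: IZR_le; have := trunc_logP (isT : 1 < 2) K_gt0; rewrite -/t; lia.
have two_t : (0 < 2 ^ t)%R by apply: pow_lt; lra.
have ln_N : (IZR (Z.of_nat t) * ln 2 <= ln N)%R.
  rewrite -INR_IZR_INZ -ln_pow; last lra.
  by apply: Rnot_lt_le => /ln_lt_inv; lra.
have exp_N : (1 + delta * ln N <= Rpower N delta)%R.
  by rewrite /Rpower; apply: exp_ineq1_le.
have t_ge0 : (0 <= IZR (Z.of_nat t))%R by apply: IZR_le; lia.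
have dl_gt0 := Rmult_lt_0_compat _ _ delta_gt0 ln2_gt0.
have t_le : (IZR (Z.of_nat t) <= / (delta * ln 2) * Rpower N delta)%R.
  apply: (Rmult_le_reg_l (delta * ln 2)) => //.
  rewrite -Rmult_assoc Rinv_r; last lra.
  have := Rmult_le_compat_l delta _ _ (Rlt_le _ _ delta_gt0) ln_N; lra.
have : (1 <= Rpower N delta)%R.
  have : (0 <= delta * (IZR (Z.of_nat t) * ln 2))%R.
    by apply: Rmult_le_pos; [lra | apply: Rmult_le_pos; lra].
  have := Rmult_le_compat_l delta _ _ (Rlt_le _ _ delta_gt0) ln_N; lra.
rewrite Nat2Z.inj_succ succ_IZR; lra.
Qed.

(** Stated for a general [Q] between [q] and [N * N], which keeps both exponents out of the
    argument. The integer [up N - 1] is the floor of [N]. *)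
Lemma three_fractions_up_to_log (N alpha : R) (a q : Z) (Q : R) :
  (1 <= N -> 1 <= IZR q -> IZR q <= Q -> Q <= N * N ->
   Z.gcd a q = 1%Z -> Rabs (alpha - IZR a / IZR q) <= 1 / (IZR q * Q) ->
   let l := IZR (Z.of_nat (trunc_log 2 (Z.to_nat (up N - 1))).+1) in
   exists a1 a2 a3 q1 q2 q3 : Z,
    (1 <= q1)%Z /\ IZR q1 <= N /\ (1 <= q2)%Z /\ IZR q2 <= N /\
    (1 <= q3)%Z /\ IZR q3 <= N /\
    Rabs (alpha - IZR a1 / IZR q1 - IZR a2 / IZR q2 - IZR a3 / IZR q3) * (IZR q * Q)
      <= (1 + 640 * 18 ^ 6) * l ^ 6)%R.
Proof.
move=> N_ge1 q_ge1 le_qQ le_QN gcd1 approx.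
set K := Z.to_nat _; move=> l.
have [up_gt up_le] := archimed N.
have up_ge2 : (1 < up N)%Z by apply: lt_IZR; lra.
have def_K : Z.of_nat K = (up N - 1)%Z by rewrite /K Z2Nat.id; lia.
have K_gt0 : 0 < K by lia.
have le_KN : (IZR (Z.of_nat K) <= N)%R by rewrite def_K minus_IZR; lra.
have lt_NK : (N <= IZR (Z.of_nat K) + 1)%R by rewrite def_K minus_IZR; lra.
have K_ge1 : (1 <= IZR (Z.of_nat K))%R by apply: IZR_le; lia.
have l_ge1 : (1 <= l)%R by apply: IZR_le; lia.
have qQ_gt0 : (0 < IZR q * Q)%R by apply: Rmult_lt_0_compat; lra.
(* From [N <= K + 1 <= 2 * K]. *)
have Q_le : (Q <= 4 * IZR (Z.of_nat K) ^ 2)%R by nra.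
have l6_ge1 : (1 <= l ^ 6)%R by apply: pow_R1_Rle.
case: (leqP (18 * (trunc_log 2 K).+1) K) => [le_lK|lt_Kl].
  have q_leZ : (q <= 4 * Z.of_nat K ^ 2)%Z.
    by apply: le_IZR; rewrite mult_IZR -(pow_IZR _ 2); lra.
  have [a1 [a2 [a3 [q1 [q2 [q3 [q_bounds err]]]]]]] :=
    exists_three_fractions (@trunc_log_ltn 2 K isT) (ltn0Sn _) le_lK (le_IZR 1 q q_ge1) q_leZ gcd1.
  have le_N q' : (1 <= q' <= Z.of_nat K)%Z -> (IZR q' <= N)%R.
    by case=> _ /IZR_le; lra.
  exists a1, a2, a3, q1, q2, q3; case: q_bounds => [b1 [b2 b3]].
  do 6![split; [by [apply: le_N | lia]|]].
  move: err; rewrite -/l; set A := (IZR a / IZR q)%R in approx *.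
  set E := Rabs _ => err.
  have E_ge0 : (0 <= E)%R by apply: Rabs_pos.
  (* Passing from [alpha] to [a / q] costs the 1 in the constant; [Q <= 4 * K ^ 2] turns 160 into
     640, and 8 is weakened to 18. *)
  apply: Rle_trans (_ : (1 / (IZR q * Q) + E) * (IZR q * Q) <= _)%R.
    apply: Rmult_le_compat_r; first lra.
    apply: Rle_trans (Rplus_le_compat_r E _ _ approx).
    rewrite (_ : alpha - _ - _ - _ = (alpha - A) +
      (A - IZR a1 / IZR q1 - IZR a2 / IZR q2 - IZR a3 / IZR q3))%R; last by lra.
    exact: Rabs_triang.
  have -> : ((1 / (IZR q * Q) + E) * (IZR q * Q) = 1 + E * (IZR q * Q))%R.
    by field; lra.
  have : (E * (IZR q * Q) <= 4 * (E * (IZR q * IZR (Z.of_nat K) ^ 2)))%R.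
    have Eq_ge0 : (0 <= E * IZR q)%R by apply: Rmult_le_pos; lra.
    by have := Rmult_le_compat_l _ _ _ Eq_ge0 Q_le; lra.
  have : ((8 * l) ^ 6 <= 18 ^ 6 * l ^ 6)%R.
    by rewrite -Rpow_mult_distr; apply: pow_incr; lra.
  lra.
(* Now [K < 18 * l], so [q * Q <= Q ^ 2 <= 16 * 18 ^ 4 * l ^ 4] and an error of 1 is affordable: the
   floor of [alpha] suffices. *)
exists (up alpha - 1)%Z, 0%Z, 0%Z, 1%Z, 1%Z, 1%Z.
do 3![split; [by []|split; [lra|]]].
have [up_alpha_gt up_alpha_le] := archimed alpha.
have err : (Rabs (alpha - IZR (up alpha - 1) / 1 - 0 / 1 - 0 / 1) <= 1)%R.
  by rewrite minus_IZR; apply: Rabs_le; lra.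
have K_le : (IZR (Z.of_nat K) <= 18 * l)%R.
  by rewrite /l -mult_IZR; apply: IZR_le; lia.
apply: Rle_trans (Rmult_le_compat_r _ _ _ (Rlt_le _ _ qQ_gt0) err) _.
rewrite Rmult_1_l.
have K2_le : (IZR (Z.of_nat K) ^ 2 <= (18 * l) ^ 2)%R by apply: pow_incr; lra.
have Q_le' : (Q <= 4 * (18 * l) ^ 2)%R by lra.
apply: Rle_trans (_ : (4 * (18 * l) ^ 2) * (4 * (18 * l) ^ 2) <= _)%R.
  by apply: Rmult_le_compat; lra.
have : (l ^ 4 <= l ^ 6)%R by apply: Rle_pow => //; lia.
have -> : (4 * (18 * l) ^ 2 * (4 * (18 * l) ^ 2) = 16 * 18 ^ 4 * l ^ 4)%R by ring.
lra.
Qed.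

Open Scope R_scope.

Theorem theorem3 :
  forall eps : R, 0 < eps ->
  exists C : R, 0 < C /\
  forall (eps' N alpha : R) (a q : Z),
    0 < eps' -> 1 <= N ->
    (1 <= q)%Z -> IZR q <= Rpower N (2 - eps') ->
    Z.gcd a q = 1%Z ->
    Rabs (alpha - IZR a / IZR q) <= 1 / (IZR q * Rpower N (2 - eps')) ->
    exists (a1 a2 a3 q1 q2 q3 : Z),
      (1 <= q1)%Z /\ IZR q1 <= N /\
      (1 <= q2)%Z /\ IZR q2 <= N /\
      (1 <= q3)%Z /\ IZR q3 <= N /\
      Rabs (alpha - IZR a1 / IZR q1 - IZR a2 / IZR q2 - IZR a3 / IZR q3)
        <= C / (IZR q * Rpower N (2 - eps' - eps)).
Proof.
move=> eps eps_gt0.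
(* The loss is a sixth power of [l], so each factor may cost [Rpower N (eps / 6)]. *)
pose delta := eps / 6; have delta_gt0 : 0 < delta by rewrite /delta; lra.
pose c := 1 + / (delta * ln 2).
have ln2_gt0 : 0 < ln 2 by rewrite -ln_1; apply: ln_increasing; lra.
have c_gt0 : 0 < c.
  have := Rinv_0_lt_compat _ (Rmult_lt_0_compat _ _ delta_gt0 ln2_gt0).
  by rewrite /c; lra.
exists ((1 + 640 * 18 ^ 6) * c ^ 6); split.
  by apply: Rmult_lt_0_compat; [lra | apply: pow_lt].
move=> eps' N alpha a q eps'_gt0 N_ge1 /IZR_le q_ge1 le_q gcd1 approx.
set Q := Rpower N (2 - eps') in le_q approx.
have Q_le : Q <= N * N.
  rewrite (_ : N * N = Rpower N 2); first by apply: Rle_Rpower; lra.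
  by rewrite (Rpower_pow 2 N) /=; lra.
have [a1 [a2 [a3 [q1 [q2 [q3 [h1 [h2 [h3 [h4 [h5 [h6 err]]]]]]]]]]]] :=
  three_fractions_up_to_log N_ge1 q_ge1 le_q Q_le gcd1 approx.
exists a1, a2, a3, q1, q2, q3; do 6!split => //.
move: err; set l := IZR (Z.of_nat _); set E := Rabs _ => err.
have Ne_gt0 : 0 < Rpower N eps by apply: exp_pos.
have -> : Rpower N (2 - eps' - eps) = Q / Rpower N eps.
  by rewrite /Rdiv -Rpower_Ropp -Rpower_plus; congr Rpower; lra.
have [up_gt up_le] := archimed N.
have up_ge2 : (1 < up N)%Z by apply: lt_IZR; lra.
have l_le : l <= c * Rpower N delta.
  apply: trunc_log_le_Rpower => //; first lia.
  by rewrite Z2Nat.id ?minus_IZR; [lra | lia].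
have l_ge0 : 0 <= l by apply: IZR_le; lia.
have l6_le : l ^ 6 <= c ^ 6 * Rpower N eps.
  have -> : Rpower N eps = Rpower N delta ^ 6.
    rewrite -Rpower_pow; last exact: exp_pos.
    by rewrite Rpower_mult; congr Rpower; rewrite /delta /=; lra.
  by rewrite -Rpow_mult_distr; apply: pow_incr.
have qQ_gt0 : 0 < IZR q * Q by apply: Rmult_lt_0_compat; lra.
apply: (Rmult_le_reg_r (IZR q * Q)) => //; apply: Rle_trans err _.
have -> : (1 + 640 * 18 ^ 6) * c ^ 6 / (IZR q * (Q / Rpower N eps)) * (IZR q * Q) =
    (1 + 640 * 18 ^ 6) * (c ^ 6 * Rpower N eps).
  by field; repeat split; apply: Rgt_not_eq; lra.
by apply: Rmult_le_compat_l => //; lra.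
Qed.
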